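(* Let $n\ge1$ be an integer, let $l_{Y,n},u_{X,n},u_{Y,n}$ be positive finite constants, and let $\mathcal{P}$ be the class of all distributions $P$ on $\mathbb{R}^2$ such that, for $(X_{1,n},Y_{1,n})\sim P$, $\mathbb{E}[Y_{1,n}]\ge l_{Y,n}>0$, $\mathbb{E}[X_{1,n}^2]\le u_{X,n}$ and $\mathbb{E}[Y_{1,n}^2]\le u_{Y,n}$. Let $\underline{\alpha}_n:=\big(1-l_{Y,n}^2/u_{Y,n}\big)^n$. If $l_{Y,n}^2/u_{Y,n}<1$, then for every $\alpha\in(0,\underline{\alpha}_n)$ there is no finite $t>0$ such that the interval $\big[\overline{X}_n/\overline{Y}_n-t,\ \overline{X}_n/\overline{Y}_n+t\big]$ has coverage $1-\alpha$ over $\mathcal{P}$.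
   Context: Under $P^{\otimes n}$, $(X_{i,n},Y_{i,n})_{i=1,\dots,n}$ are i.i.d. with distribution $P$; $\overline{X}_n,\overline{Y}_n$ are the empirical means. The parameter is $\theta(P):=\mathbb{E}_P[X_{1,n}]/\mathbb{E}_P[Y_{1,n}]$. A confidence set $C_n$ has coverage $1-\alpha$ over $\mathcal{P}$ if $\inf_{P\in\mathcal{P}}\mathbb{P}_{P^{\otimes n}}(C_n\ni\theta(P))\ge1-\alpha$. When $\overline{Y}_n=0$ the interval is undefined, and the event $\{C_n\ni\theta(P)\}$ contains only outcomes at which $C_n$ is defined: for every real $a$, $\mathbb{P}(a\in C_n)+\mathbb{P}(a\notin C_n)+\mathbb{P}(C_n\text{ undefined})=1$. *)

(* Defs.v *)
From HB Require Import structures.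
From mathcomp Require Import all_boot all_order all_algebra.
From mathcomp Require Import all_classical all_reals all_analysis.

Set Implicit Arguments.
Unset Strict Implicit.
Unset Printing Implicit Defensive.
Import Order.TTheory GRing.Theory Num.Theory.
Import numFieldNormedType.Exports.

Local Open Scope classical_set_scope.
Local Open Scope ring_scope.

Definition cons_pair (T : Type) (n : nat) (w : T * n.-tuple T) : n.+1.-tuple T :=
  [tuple of w.1 :: w.2].

Lemma measurable_cons_pair d (T : measurableType d) (n : nat) :
  measurable_fun [set: T * n.-tuple T] (@cons_pair T n).
Proof. exact: measurable_cons. Qed.

HB.instance Definition _ d (T : measurableType d) (n : nat) :=
  @isMeasurableFun.Build _ _ _ _ (@cons_pair T n) (@measurable_cons_pair d T n).

(* The n-fold product P (x) ... (x) P, on n-tuples with the product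
   sigma-algebra. *)
Fixpoint power_probability d (T : measurableType d) (R : realType)
    (P : probability T R) (n : nat) : probability (n.-tuple T) R :=
  match n with
  | 0 => \d_([tuple] : 0.-tuple T)
  | m.+1 => distribution (P \x power_probability P m)%E (@cons_pair T m)
  end.

Lemma power_probabilityE d (T : measurableType d) (R : realType)
    (P : probability T R) (n : nat) (A : 'I_n -> set T) :
  (forall i, measurable (A i)) ->
  power_probability P n [set w | forall i, A i (tnth w i)] =
  (\prod_(i < n) P (A i))%E.
Proof.
elim: n A => [|n IHn] A mA.
  by rewrite big_ord0 /= diracE mem_set//= => -[].
rewrite big_ord_recl /= /distribution /pushforward.
rewrite (_ : _ @^-1` _ =
  A ord0 `*` [set w : n.-tuple T | forall i, A (lift ord0 i) (tnth w i)]).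
  rewrite product_measure1E//.
    by congr (_ * _)%E; exact: (IHn (fun i => A (lift ord0 i))).
  have -> : [set w : n.-tuple T | forall i, A (lift ord0 i) (tnth w i)] =
      \bigcap_(i in [set: 'I_n])
        ((fun w : n.-tuple T => tnth w i) @^-1` A (lift ord0 i)).
    by apply/seteqP; split => w /= h i; [move=> _|]; exact: h.
  apply: fin_bigcap_measurable => // i _.
  by rewrite -[X in measurable X]setTI; exact: measurable_tnth.
apply/seteqP; split => -[x w] /= h.
  split => [|i]; first by have := h ord0; rewrite tnth0.
  by have := h (lift ord0 i); rewrite tnthS.
by move=> i; case: (unliftP ord0 i) => [j|] ->; rewrite ?tnthS ?tnth0;
  [exact: h.2|exact: h.1].
Qed.

Section ratio_of_means.
Context {R : realType}.
Local Open Scope ereal_scope.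

Definition moment_class (lY uX uY : R) : set (probability (R * R)%type R) :=
  [set P | [/\ lY%:E <= 'E_P[fun z : R * R => z.2],
               'E_P[fun z : R * R => (z.1 ^+ 2)%R] <= uX%:E &
               'E_P[fun z : R * R => (z.2 ^+ 2)%R] <= uY%:E]].

(* [fine] is harmless on moment_class: the second-moment bounds make both
   expectations finite. *)
Definition theta (P : probability (R * R)%type R) : R :=
  (fine 'E_P[fun z : R * R => z.1] / fine 'E_P[fun z : R * R => z.2])%R.

Definition mean_fst n (w : n.-tuple (R * R)) : R :=
  (n%:R^-1 * \sum_(i < n) (tnth w i).1)%R.

Definition mean_snd n (w : n.-tuple (R * R)) : R :=
  (n%:R^-1 * \sum_(i < n) (tnth w i).2)%R.

(* A confidence set may be undefined (None) at some samples; the event that it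
   contains a holds only at samples where it is defined. *)
Definition confidence_set n := n.-tuple (R * R) -> option (set R).

Definition contains n (C : confidence_set n) (a : R) : set (n.-tuple (R * R)) :=
  [set w | if C w is Some A then A a else False].

Definition has_coverage n (C : confidence_set n)
    (Pc : set (probability (R * R)%type R)) (p : R) : Prop :=
  p%:E <= ereal_inf [set power_probability P n (contains C (theta P)) | P in Pc].

Definition ratio_interval n (t : R) : confidence_set n := fun w =>
  if mean_snd w == 0%R then None
  else Some `[(mean_fst w / mean_snd w - t)%R,
              (mean_fst w / mean_snd w + t)%R]%classic.

Definition alpha_low (n : nat) (lY uY : R) : R := ((1 - lY ^+ 2 / uY) ^+ n)%R.

End ratio_of_means.
Arguments ratio_interval {R} n t w.

(* Main.v *)
Require Import Defs.
From HB Require Import structures.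
From mathcomp Require Import all_boot all_order all_algebra.
From mathcomp Require Import all_classical all_reals all_analysis.
From mathcomp Require Import measurable_realfun ring lra.
Import Order.TTheory GRing.Theory Num.Theory.
Local Open Scope ring_scope.

(** Let [X = 0] and let [Y] take the value [uY / lY] with probability
    [lY ^+ 2 / uY] and [0] otherwise: then [Y] has mean [lY] and second moment
    [uY]. The whole sample of [Y] vanishes with probability [alpha_low n lY uY],
    and then the interval is undefined whatever [t] is, so that its coverage is
    at most [1 - alpha_low n lY uY]. *)

Lemma measurable_mean_fst {R : realType} (n : nat) :
  measurable_fun [set: n.-tuple (R * R)] (@mean_fst R n).
Proof.
apply: measurable_funM => //; apply: measurable_sum => i.
by apply: measurableT_comp => //; exact: measurable_tnth.
Qed.

Lemma measurable_mean_snd {R : realType} (n : nat) :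
  measurable_fun [set: n.-tuple (R * R)] (@mean_snd R n).
Proof.
apply: measurable_funM => //; apply: measurable_sum => i.
by apply: measurableT_comp => //; exact: measurable_tnth.
Qed.

(* Clearing the denominator in the membership condition spares the
   measurability of inversion. *)
Lemma contains_ratio_intervalE {R : realType} (n : nat) (t a : R) :
  contains (ratio_interval n t) a =
  ((@mean_snd R n @^-1` (~` [set 0])) `&`
   [set w | `|mean_fst w - a * mean_snd w| <= t * `|mean_snd w|])%classic.
Proof.
apply/seteqP; split=> w; rewrite /contains /ratio_interval /=;
  case: (eqVneq (mean_snd w) 0) => [y0|yn0] /=.
- by [].
- have -> : mean_fst w - a * mean_snd w =
      (mean_fst w / mean_snd w - a) * mean_snd w by rewrite mulrBl divfK.
  rewrite normrM ler_pM2r ?normr_gt0// ler_norml in_itv/= => /andP[? ?].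
  by split; [exact/eqP|lra].
- by case.
- have -> : mean_fst w - a * mean_snd w =
      (mean_fst w / mean_snd w - a) * mean_snd w by rewrite mulrBl divfK.
  rewrite normrM ler_pM2r ?normr_gt0// ler_norml in_itv/= => -[_ /andP[? ?]].
  by lra.
Qed.

(** Needed to apply monotonicity of the measure to the coverage event. *)
Lemma measurable_contains_ratio_interval {R : realType} (n : nat) (t a : R) :
  measurable (contains (ratio_interval n t) a).
Proof.
rewrite contains_ratio_intervalE; apply: measurableI.
  rewrite -[X in measurable X]setTI; apply: measurable_mean_snd => //.
  exact: measurableC.
rewrite -[X in measurable X]setTI; apply: measurable_fun_le => //.
  apply: measurableT_comp => //; apply: measurable_funB.
    exact: measurable_mean_fst.
  by apply: measurable_funM => //; exact: measurable_mean_snd.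
apply: measurable_funM => //.
by apply: measurableT_comp => //; exact: measurable_mean_snd.
Qed.

(** The extremal law is encoded as the image of a Bernoulli law, so that its integrals reduce to
    sums over [bool]. *)
Definition switch_snd {R : realType} (y : R) (b : bool) : R * R :=
  (0, if b then y else 0).

Lemma measurable_switch_snd {R : realType} (y : R) :
  measurable_fun [set: bool] (switch_snd y).
Proof. by []. Qed.

HB.instance Definition _ {R : realType} (y : R) :=
  isMeasurableFun.Build _ _ _ _ (switch_snd y) (measurable_switch_snd y).

Definition bernoulli_snd {R : realType} (p y : R) : probability (R * R)%type R :=
  distribution (bernoulli_prob p) (switch_snd y).

(** After a change of variables only the outcome [true] contributes, as [f] vanishes at the origin.
    The sign condition makes [f] nonnegative on both atoms, which gives the integrability that the
    change of variables requires. *)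
Lemma expectation_bernoulli_snd {R : realType} (p y : R) (f : R * R -> R) :
  0 <= p <= 1 -> measurable_fun [set: R * R] f ->
  f (0, 0) = 0 -> 0 <= f (0, y) ->
  ('E_(bernoulli_snd p y)[f] = (p * f (0, y))%:E)%E.
Proof.
move=> p01 mf f0 fy.
have f_ge0 b : (0 <= (EFin \o f \o switch_snd y) b)%E.
  by rewrite /= lee_fin; case: b => //=; rewrite /switch_snd f0.
have int_f : (\int[bernoulli_prob p]_b (EFin \o f \o switch_snd y) b =
    (p * f (0, y))%:E)%E.
  by rewrite integral_bernoulli_prob//= /switch_snd f0 mule0 adde0.
rewrite unlock integral_pushforward//=.
- exact/measurable_EFinP.
- apply/integrableP; split=> //.
  under eq_integral do rewrite gee0_abs//.
  by rewrite int_f ltry.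
Qed.

(** The equations [p * y = lY] and [p * y ^+ 2 = uY] force this weight and this atom. By
    Cauchy-Schwarz, no law in the class gives [Y = 0] more mass. *)
Lemma bernoulli_snd_moment_class {R : realType} {lY uX uY : R} :
  0 < lY -> 0 < uX -> 0 < uY -> lY ^+ 2 / uY <= 1 ->
  moment_class lY uX uY (bernoulli_snd (lY ^+ 2 / uY) (uY / lY)).
Proof.
move=> lY0 uX0 uY0 p1.
have p01 : 0 <= lY ^+ 2 / uY <= 1 by rewrite p1 divr_ge0 ?sqr_ge0 ?ltW.
have lYn0 : lY != 0 by rewrite gt_eqF.
have uYn0 : uY != 0 by rewrite gt_eqF.
have y0 : 0 <= uY / lY by rewrite divr_ge0 ?ltW.
have mfst2 :=
  measurable_funX 2 (@measurable_fst _ _ (measurableTypeR R) (measurableTypeR R)).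
have msnd2 :=
  measurable_funX 2 (@measurable_snd _ _ (measurableTypeR R) (measurableTypeR R)).
split; rewrite expectation_bernoulli_snd//= ?expr0n ?exprn_ge0//= ?lee_fin.
- by have -> : lY ^+ 2 / uY * (uY / lY) = lY by field; apply/andP.
- exact: measurable_snd.
- by rewrite mulr0 ltW.
- by have -> : lY ^+ 2 / uY * (uY / lY) ^+ 2 = uY by field; apply/andP.
Qed.

(** By independence, all second coordinates vanish with probability [q ^+ n], and the coverage event
    avoids these samples. Neither the width nor the target [a] enters the bound. *)
Lemma power_probability_ratio_interval_le {R : realType}
    {P : probability (R * R)%type R} (n : nat) (t a : R) {q : R} :
  P [set z | z.2 = 0]%classic = q%:E ->
  (power_probability P n (contains (ratio_interval n t) a) <= (1 - q ^+ n)%:E)%E.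
Proof.
move=> Pq.
pose Z : set (n.-tuple (R * R)) := [set w | forall i, (tnth w i).2 = 0]%classic.
have mZ : measurable [set z : R * R | z.2 = 0]%classic.
  rewrite -[X in measurable X]setTI.
  exact: (@measurable_snd _ _ (measurableTypeR R) (measurableTypeR R) measurableT
    _ (measurable_set1 0)).
have PZ : power_probability P n Z = (q ^+ n)%:E.
  rewrite (power_probabilityE P (fun=> mZ)) Pq.
  by rewrite prodEFin prodr_const card_ord.
have measZ : measurable Z.
  have -> : Z = (\bigcap_(i in [set: 'I_n])
      ((fun w : n.-tuple (R * R) => tnth w i) @^-1` [set z | z.2 = 0]))%classic.
    by apply/seteqP; split => w /= h i; [move=> _|]; exact: h.
  apply: fin_bigcap_measurable => // i _.
  by rewrite -[X in measurable X]setTI; exact: measurable_tnth.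
rewrite EFinB -PZ -probability_setC//; apply: le_measure.
- by rewrite inE; exact: measurable_contains_ratio_interval.
- by rewrite inE; exact: measurableC.
(* Coverage requires a nonzero [mean_snd w], whereas on [Z] every summand is zero. *)
- move=> w; rewrite contains_ratio_intervalE => -[+ _] Zw; apply.
  by rewrite /= /mean_snd big1 ?mulr0// => i _; exact: Zw.
Qed.

Theorem proposition5p1 (R : realType) (n : nat) (lY uX uY : R) :
  (1 <= n)%N -> 0 < lY -> 0 < uX -> 0 < uY ->
  lY ^+ 2 / uY < 1 ->
  forall alpha : R, 0 < alpha -> alpha < alpha_low n lY uY ->
  ~ exists t : R, 0 < t /\
      has_coverage (ratio_interval n t) (moment_class lY uX uY) (1 - alpha).
Proof.
move=> _ lY0 uX0 uY0 p1 alpha _ alpha_lt [t [_ cov]].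
pose p := lY ^+ 2 / uY; pose P := bernoulli_snd p (uY / lY).
have y0 : uY / lY != 0 by rewrite gt_eqF// divr_gt0.
have p01 : 0 <= p <= 1 by rewrite (ltW p1) divr_ge0 ?sqr_ge0 ?ltW.
(* Since [uY / lY] is nonzero, only the outcome [false] yields a zero second coordinate. *)
have PY0 : P [set z | z.2 = 0]%classic = (1 - p)%:E.
  rewrite /P /= bernoulli_probE//
    !diracE memNset ?mem_set//=; last exact/eqP.
  by rewrite mule0 add0e mule1.
(* The infimum is at most the coverage at [P]. As the bound holds for every target, [theta P] need
   not be computed. *)
have := le_trans cov (ereal_inf_lbound (ex_intro2 _ _ P
  (bernoulli_snd_moment_class lY0 uX0 uY0 (ltW p1)) erefl)).
move=> /le_trans/(_ (power_probability_ratio_interval_le n t (theta P) PY0)).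
(* What remains is [1 - alpha <= 1 - (1 - p) ^+ n], contradicting [alpha < alpha_low n lY uY]. *)
by rewrite lee_fin lerD2l lerN2 leNgt alpha_lt.
Qed.
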